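(* Let $k\le n$ be positive integers, $m=\binom nk$, let $\nu$ be a vector norm on $\mathbb{C}^n$ and $\mu$ an absolute operator norm on $\mathbb{C}^{m\times m}$. For $A\in\mathbb{C}^{n\times n}$ with eigenvalues $\lambda_1(A),\ldots,\lambda_n(A)$ ordered so that $|\lambda_1(A)|\ge\cdots\ge|\lambda_n(A)|$, $$\left|\prod_{i=1}^k\lambda_i(A)\right|\le\theta_k(\mu,\nu)\min\left\{\max_{|\alpha|=k}\prod_{i\in\alpha}\nu(\mathrm{col}_i(A)),\ \max_{|\alpha|=k}\prod_{i\in\alpha}\nu(\mathrm{row}_i(A))\right\},$$ where the maxima are over subsets $\alpha\subseteq\{1,\ldots,n\}$ with $|\alpha|=k$.
   Context: $\mathrm{col}_i(A)$ is the $i$th column of $A$ and $\mathrm{row}_i(A)\in\mathbb{C}^n$ is the transpose of the $i$th row. $C_k(B)$ is the $k$th compound of $B$ (the $\binom nk\times\binom nk$ matrix of $k\times k$ minors). $\theta_k(\mu,\nu)=\max\{\mu(C_k(B)): B\in\mathbb{C}^{n\times n},\ \nu(\mathrm{col}_i(B))=1,\ i=1,\ldots,n\}$. An absolute operator norm is a matrix norm induced by an absolute vector norm. *)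

(* Defs.v *)
From HB Require Import structures.
From mathcomp Require Import all_boot all_order all_algebra.
From mathcomp Require Import complex.
From mathcomp Require Import boolp classical_sets reals.
Set Implicit Arguments. Unset Strict Implicit. Unset Printing Implicit Defensive.
Import Order.TTheory GRing.Theory Num.Theory.
Local Open Scope classical_set_scope.
Local Open Scope ring_scope.

Section Defs.
Variable R : realType.
Local Notation C := (R[i]).

Definition is_vnorm p (nu : 'cV[C]_p -> R) : Prop :=
  [/\ (forall x, 0 <= nu x),
      (forall x, nu x = 0 -> x = 0),
      (forall (a : C) x, nu (a *: x) = Normc.normc a * nu x) &
      (forall x y, nu (x + y) <= nu x + nu y)].

Definition absv p (x : 'cV[C]_p) : 'cV[C]_p := map_mx (fun z => ((Normc.normc z)%:C)%C) x.

Definition is_abs_vnorm p (nu : 'cV[C]_p -> R) : Prop :=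
  is_vnorm nu /\ forall x, nu (absv x) = nu x.

Definition induced_norm p (eta : 'cV[C]_p -> R) (M : 'M[C]_p) : R :=
  sup [set t : R | exists x : 'cV[C]_p, eta x = 1 /\ t = eta (M *m x)].

Definition is_abs_opnorm p (mu : 'M[C]_p -> R) : Prop :=
  exists eta : 'cV[C]_p -> R, is_abs_vnorm eta /\ forall M, mu M = induced_norm eta M.

Definition ksub n k : {set {set 'I_n}} := [set S : {set 'I_n} | #|S| == k].

Lemma card_ksub n k : #|ksub n k| = 'C(n, k).
Proof. by rewrite /ksub card_draws card_ord. Qed.

Definition ksubset n k (a : 'I_('C(n, k))) : {set 'I_n} :=
  enum_val (cast_ord (esym (card_ksub n k)) a).

(* the k x k minor of B with rows S and columns T (both listed increasingly) *)
Definition minor n k (B : 'M[C]_n) (S T : {set 'I_n}) : C :=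
  \det (\matrix_(i < k, j < k)
          nth 0 (nth [::] [seq [seq B r c | c <- enum T] | r <- enum S] i) j).

Definition compound n k (B : 'M[C]_n) : 'M[C]_('C(n, k)) :=
  \matrix_(a, b) minor k B (ksubset a) (ksubset b).

Definition theta n k (mu : 'M[C]_('C(n, k)) -> R) (nu : 'cV[C]_n -> R) : R :=
  sup [set t : R | exists B : 'M[C]_n,
         (forall i : 'I_n, nu (col i B) = 1) /\ t = mu (compound k B)].

End Defs.

(* Main.v *)
Require Import Defs.
From HB Require Import structures.
From mathcomp Require Import all_boot all_order all_algebra.
From mathcomp Require Import perm complex.
From mathcomp Require Import boolp classical_sets reals.
From mathcomp Require Import topology normedtype derive lra.
Import Order.TTheory GRing.Theory Num.Theory.
Import numFieldNormedType.Exports.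
Set Implicit Arguments. Unset Strict Implicit. Unset Printing Implicit Defensive.
Local Open Scope ring_scope.

(** Write [A = B D] with [D] the diagonal matrix of the column norms and [B] with
    columns of norm 1. Then [C_k(A) = C_k(B) C_k(D)], where [C_k(D)] is diagonal
    with entries the products of [k] column norms, and an absolute vector norm
    [eta] satisfies [eta (C_k(D) x) <= max_a |C_k(D)_aa| eta x]. Hence every
    eigenvalue of [C_k(A)] is at most [theta_k(mu, nu)] times the maximal product
    of column norms, and by Cauchy-Binet [lam_1 ... lam_k] is such an eigenvalue.
    The row bound is the column bound of the transpose. As [theta] is a supremum
    ([0] on unbounded sets), boundedness is needed as well: it follows from the
    compactness of the unit sphere of [C^n]. *)

(** * Characteristic polynomials and triangularization *)

Lemma char_poly_tr (F : comNzRingType) n (A : 'M[F]_n) : char_poly A^T = char_poly A.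
Proof.
rewrite /char_poly -det_tr; congr (\det _).
by rewrite /char_poly_mx linearB /= tr_scalar_mx map_trmx trmxK.
Qed.

Lemma char_poly_similar (F : fieldType) n (P A B : 'M[F]_n) :
  P \in unitmx -> P *m A = B *m P -> char_poly A = char_poly B.
Proof.
rewrite unitmxE unitfE => P0 PA; have: map_mx polyC P *m char_poly_mx A =
    char_poly_mx B *m map_mx polyC P.
  rewrite mulmxBr mulmxBl -!map_mxM PA; congr (_ - _).
  by rewrite scalar_mxC.
move/(congr1 determinant); rewrite !det_mulmx mulrC det_map_mx.
by move/mulIf; apply; rewrite polyC_eq0.
Qed.

Lemma char_poly_lblock (F : comNzRingType) m n (A : 'M[F]_m) (B : 'M[F]_(n, m)) (C : 'M[F]_n) :
  char_poly (block_mx A 0 B C) = char_poly A * char_poly C.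
Proof.
rewrite /char_poly -(det_lblock _ (- map_mx polyC B)); congr (\det _).
by rewrite /char_poly_mx map_block_mx map_mx0 scalar_mx_block opp_block_mx add_block_mx
   subr0 sub0r.
Qed.

(** Induction on [n]: a left eigenvector for [lam ord0], taken as first row of a basis, makes [A]
    block lower triangular, and the other diagonal block carries the remaining [lam]. Keeping the
    given order on the diagonal makes the leading minors of [T] products of the first [lam i]. *)
Lemma trigonalization (F : fieldType) n (A : 'M[F]_n) (lam : 'I_n -> F) :
  char_poly A = \prod_(i < n) ('X - (lam i)%:P) ->
  exists P T : 'M[F]_n,
    [/\ P \in unitmx, is_trig_mx T, P *m A = T *m P & forall i, T i i = lam i].
Proof.
elim: n A lam => [|n IH] A lam charA.
  by exists 1%:M, A; split=> [|||[]//]; rewrite ?unitmx1 ?mul1mx ?mulmx1 //; apply/is_trig_mxP=> -[].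
have: eigenvalue A (lam ord0).
  by rewrite eigenvalue_root_char charA rootE horner_prod big_ord_recl !hornerE subrr mul0r.
move=> /eigenvalueP [v vA v0].
(* The first row of the basis [row_ebase v] is proportional to [v], which has rank 1. *)
pose Q : 'M[F]_(1 + n) := row_ebase v; have uQ : Q \in unitmx by apply: row_ebase_unit.
have [c c0 vQ] : exists2 c, c != 0 & v = c *: row ord0 Q.
  have r1 : \rank v = 1%N by rewrite rank_rV v0.
  have := mulmx_ebase v; rewrite r1 [col_ebase v]mx11_scalar; set c := col_ebase v _ _ => vE.
  have vE' : v = c *: row ord0 Q.
    rewrite -vE -mulmxA mul_scalar_mx; congr (_ *: _).
    by apply/rowP => j; rewrite !mxE big_ord_recl big1 => [|i _]; rewrite !mxE /= ?mul1r ?addr0 ?mul0r.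
  by exists c => //; apply: contraNneq v0 => c0; rewrite vE' c0 scale0r.
have QA : row ord0 Q *m A = lam ord0 *: row ord0 Q.
  apply: (scalerI c0); rewrite scalemxAl -vQ vA vQ !scalerA mulrC //.
pose A' : 'M[F]_(1 + n) := Q *m A *m invmx Q.
have QA' : Q *m A = A' *m Q by rewrite mulmxKV.
have rowA' j : A' ord0 j = lam ord0 * (ord0 == j)%:R.
  have : row ord0 A' = lam ord0 *: row ord0 1%:M.
    by rewrite -(mulmxV uQ) !row_mul QA -scalemxAl.
  by move/rowP/(_ j); rewrite !mxE.
clearbody A'; set B := dlsubmx A'; set C := drsubmx A'.
have A'E : A' = block_mx (lam ord0)%:M 0 B C.
  rewrite -[LHS]submxK; congr block_mx; apply/matrixP=> i j; rewrite !mxE ord1 lshift0 rowA'.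
    by rewrite ord1 lshift0 eqxx mulr1 mulr1n.
  by rewrite rshift1 (negbTE (neq_lift _ _)) mulr0.
have charC : char_poly C = \prod_(i < n) ('X - (lam (lift ord0 i))%:P).
  have := charA; rewrite (char_poly_similar uQ QA') A'E char_poly_lblock big_ord_recl.
  rewrite char_poly_trig ?scalar_mx_is_trig // big_ord1 !mxE mulr1n.
  by apply: mulfI; rewrite polyXsubC_eq0.
have [P [T [uP trigT PC Tlam]]] := IH _ _ charC.
exists (block_mx 1%:M 0 0 P *m Q), (block_mx (lam ord0)%:M 0 (P *m B) T); split.
- by rewrite unitmx_mul uQ andbT unitmxE (@det_lblock _ 1 n) det1 mul1r -unitmxE.
- by rewrite (@is_trig_block_mx _ 1 n 1 n) // eqxx scalar_mx_is_trig.
- rewrite -mulmxA QA' mulmxA A'E mulmxA; congr (_ *m _).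
  by rewrite !(@mulmx_block _ 1 n 1 n 1 n) !mul1mx !mul0mx !mulmx0 !mulmx1 !addr0 !add0r PC.
- move=> i; case: (unliftP ord0 i) => [j ->|->].
    by rewrite -[lift _ _](rshift1 j) (@block_mxEdr _ 1 n 1 n) Tlam rshift1.
  by rewrite -[ord0](lshift0 n 0) (@block_mxEul _ 1 n 1 n) mxE eqxx mulr1n.
Qed.

(** * The Cauchy-Binet formula *)

Section CauchyBinet.
Variables (F : comNzRingType) (n : nat) (i0 : 'I_n).

(* The [i]-th smallest element of [S]; [i0] is a junk value, taken when [#|S| <= i]. *)
Definition kth k (S : {set 'I_n}) (i : 'I_k) : 'I_n := nth i0 (enum S) i.

Lemma kth_inj k (S : {set 'I_n}) : #|S| = k -> injective (@kth k S).
Proof.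
move=> Sk i j /eqP; rewrite /kth nth_uniq ?enum_uniq -?cardE ?Sk //.
by move/eqP/val_inj.
Qed.

Lemma kth_mem k (S : {set 'I_n}) i : #|S| = k -> @kth k S i \in S.
Proof. by move=> Sk; rewrite -mem_enum mem_nth // -cardE Sk. Qed.

Lemma kth_onto k (S : {set 'I_n}) x : #|S| = k -> x \in S -> exists i, x = @kth k S i.
Proof.
move=> Sk; rewrite -mem_enum => xS.
have ltx : (index x (enum S) < k)%N by rewrite -Sk cardE index_mem.
by exists (Ordinal ltx); rewrite /kth nth_index.
Qed.

(** In the Leibniz formula for [P *m Q], distributing the product over the sums amounts to choosing
    a middle index [f i] for each row [i]. *)
Lemma det_mulmx_ffun k (P : 'M[F]_(k, n)) (Q : 'M[F]_(n, k)) :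
  \det (P *m Q) = \sum_(f : {ffun 'I_k -> 'I_n}) (\prod_i P i (f i)) * \det (rowsub f Q).
Proof.
rewrite /determinant; under [RHS]eq_bigr do rewrite big_distrr.
rewrite exchange_big /=; apply: eq_bigr => s _.
under eq_bigr do rewrite mxE.
rewrite bigA_distr_bigA big_distrr /=; apply: eq_bigr => f _.
rewrite mulrCA; congr (_ * _); rewrite -big_split.
by apply: eq_bigr => i _; rewrite !mxE.
Qed.

(** A non-injective [f] repeats a row and contributes 0. The injective ones are grouped by image
    [S]: each is a unique permutation followed by [kth S], and the signs of these permutations
    assemble the determinant of the columns [S] of [P]. *)
Lemma det_mulmx_rect k (P : 'M[F]_(k, n)) (Q : 'M[F]_(n, k)) :
  \det (P *m Q) =
  \sum_(S : {set 'I_n} | #|S| == k) \det (colsub (kth S) P) * \det (rowsub (kth S) Q).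
Proof.
rewrite det_mulmx_ffun (bigID (fun f : {ffun 'I_k -> 'I_n} => injectiveb f)) /=.
rewrite addrC big1 ?add0r => [|f /injectivePn[i [j neq_ij eqf]]]; last first.
  by rewrite (determinant_alternate neq_ij) ?mulr0 // => l; rewrite !mxE eqf.
rewrite (partition_big (fun f : {ffun 'I_k -> 'I_n} => f @: [set: 'I_k])
          (fun S : {set 'I_n} => #|S| == k)) /=; last first.
  by move=> f /injectiveP fi; rewrite card_imset // cardsT card_ord.
apply: eq_bigr => S /eqP Sk.
pose h (s : 'S_k) : {ffun 'I_k -> 'I_n} := [ffun i => kth S (s i)].
have h_inj : injective h.
  by move=> s t /ffunP st; apply/permP => i; have := st i; rewrite !ffunE => /(kth_inj Sk).
have -> : \det (colsub (kth S) P) * \det (rowsub (kth S) Q) =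
    \sum_(f in h @: [set: 'S_k]) (\prod_i P i (f i)) * \det (rowsub f Q).
  rewrite big_imset /=; last by move=> ? ? _ _ /h_inj.
  rewrite {1}/determinant big_distrl /=; apply: eq_big => [s|s _]; first by rewrite inE.
  have -> : rowsub (h s) Q = row_perm s (rowsub (kth S) Q).
    by apply/matrixP => i j; rewrite !mxE ffunE.
  rewrite row_permE det_mulmx det_perm mulrA [_ * (-1) ^+ _]mulrC.
  by congr (_ * _ * _); apply: eq_bigr => i _; rewrite mxE ffunE.
apply: eq_bigl => f; apply/andP/imsetP => [[/injectiveP fi /eqP fS]|[s _ ->]].
  have [g gE] : exists g : 'I_k -> 'I_k, forall i, f i = kth S (g i).
    by apply: (fin_all_exists (P := fun i j => f i = kth S j)) => i; apply: kth_onto => //; rewrite -fS imset_f.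
  have gi : injective g by move=> i j gij; apply: fi; rewrite !gE gij.
  by exists (perm gi) => //; apply/ffunP=> i; rewrite ffunE permE gE.
have hi : injective (h s) by move=> i j; rewrite !ffunE => /(kth_inj Sk)/perm_inj.
split; first exact/injectiveP.
rewrite eqEcard card_imset // cardsT card_ord Sk leqnn andbT.
by apply/fintype.subsetP => _ /imsetP[i _ ->]; rewrite ffunE kth_mem.
Qed.

End CauchyBinet.

(** * Compound matrices *)

Section Compound.
Variables (R : realType) (n k : nat) (i0 : 'I_n).
Local Notation C := R[i].

(** For sets of size [k] every list index is in range, so no default value of [minor] or [kth] is
    reached. *)
Lemma minor_mxsub (B : 'M[C]_n) (S T : {set 'I_n}) : #|S| = k -> #|T| = k ->
  minor k B S T = \det (mxsub (@kth _ i0 k S) (kth i0 T) B).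
Proof.
move=> Sk Tk; congr (\det _); apply/matrixP => i j; rewrite !mxE.
by rewrite (nth_map i0) -?cardE ?Sk // (nth_map i0) // -cardE Tk.
Qed.

Lemma card_ksubset (a : 'I_('C(n, k))) : #|ksubset a| = k.
Proof. by have := enum_valP (cast_ord (esym (card_ksub n k)) a); rewrite inE => /eqP. Qed.

Lemma sum_ksubset (V : nmodType) (f : {set 'I_n} -> V) :
  \sum_(S : {set 'I_n} | #|S| == k) f S = \sum_(a < 'C(n, k)) f (ksubset a).
Proof.
transitivity (\sum_(S in ksub n k) f S); first by apply: eq_bigl => S; rewrite inE.
rewrite big_enum_val; apply: reindex; apply: onW_bij.
by exists (cast_ord (card_ksub n k)); [exact: cast_ordKV | exact: cast_ordK].
Qed.

(* The eigenvector is the exterior product of the first [k] vectors of a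
   triangularizing basis; its coordinates are their [k x k] minors. *)
Lemma compound_eigenvector (A : 'M[C]_n) (lam : 'I_n -> C) : (k <= n)%N ->
  char_poly A = \prod_(i < n) ('X - (lam i)%:P) ->
  exists2 x : 'cV[C]_('C(n, k)), x != 0 & compound k A *m x = (\prod_(i < n | (i < k)%N) lam i) *: x.
Proof.
move=> lekn; rewrite -char_poly_tr => /trigonalization[P [T [uP /is_trig_mxP Ttrig PA Tlam]]].
pose w := @widen_ord k n lekn; pose W := rowsub w P; pose Tk := mxsub w w T.
(* Since [T] is lower triangular, the span of the first [k] rows of [P] is stable under [A^T]. *)
have WA : W *m A^T = Tk *m W.
  rewrite mul_rowsub_mx PA; apply/matrixP => i j; rewrite !mxE.
  rewrite (bigID (fun l : 'I_n => l < k)%N) /= addrC big1 ?add0r => [|l]; last first.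
    by rewrite -leqNgt => lekl; rewrite Ttrig ?mul0r //= (leq_trans (ltn_ord i)).
  rewrite (big_ord_narrow lekn); apply: eq_bigr => l _; rewrite !mxE.
  by [].
have detTk : \det Tk = \prod_(i < n | (i < k)%N) lam i.
  rewrite det_trig; last by apply/is_trig_mxP => i j ij; rewrite mxE Ttrig.
  by rewrite (big_ord_narrow lekn); apply: eq_bigr => i _; rewrite mxE Tlam.
pose x : 'cV[C]_('C(n, k)) := \col_a \det (colsub (kth i0 (ksubset a)) W).
exists x.
  (* [W] has a right inverse [W']; if all its maximal minors vanished, Cauchy-Binet would give
     [\det (W *m W') = 0]. *)
  have [W' WW'] : exists W', W *m W' = 1%:M.
    exists (colsub w (invmx P)); rewrite -mxsub_mul mulmxV //.
    by apply/matrixP => i j; rewrite !mxE.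
  apply/eqP => x0; have /eqP := det_mulmx_rect i0 W W'.
  rewrite WW' det1 sum_ksubset big1 ?oner_eq0 // => a _.
  by move/colP: x0 => /(_ a); rewrite !mxE => ->; rewrite mul0r.
apply/colP => a; rewrite !mxE.
(* Cauchy-Binet turns coordinate [a] into one determinant, from which [A *m W^T = W^T *m Tk^T]
   extracts [\det Tk]. *)
transitivity (\det (rowsub (kth i0 (ksubset a)) A *m W^T)).
  rewrite (det_mulmx_rect i0) sum_ksubset; apply: eq_bigr => b _.
  rewrite !mxE (minor_mxsub _ (card_ksubset a) (card_ksubset b)).
  rewrite -(det_tr (colsub _ W)).
  by congr (_ * _); congr (\det _); apply/matrixP => i j; rewrite !mxE.
have AW : A *m W^T = W^T *m Tk^T by apply: trmx_inj; rewrite !trmx_mul !trmxK.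
rewrite mul_rowsub_mx AW -mul_rowsub_mx det_mulmx det_tr detTk mulrC; congr (_ * _).
by rewrite -det_tr; congr (\det _); apply/matrixP => i j; rewrite !mxE.
Qed.

(** Selecting columns commutes with scaling them, so each minor picks up the determinant of a
    [k x k] diagonal matrix. *)
Lemma compound_mul_diag (B : 'M[C]_n) (d : 'rV[C]_n) :
  compound k (B *m diag_mx d) = compound k B *m diag_mx (\row_a \prod_(i in ksubset a) d 0 i).
Proof.
apply/matrixP => a b; rewrite mul_mx_diag !mxE.
rewrite !(minor_mxsub _ (card_ksubset a) (card_ksubset b)).
have -> : mxsub (@kth _ i0 k (ksubset a)) (@kth _ i0 k (ksubset b)) (B *m diag_mx d) =
    mxsub (kth i0 (ksubset a)) (kth i0 (ksubset b)) B *m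
    diag_mx (\row_j d 0 (kth i0 (ksubset b) j)).
  by rewrite !mul_mx_diag; apply/matrixP => i j; rewrite !mxE.
rewrite det_mulmx det_diag; congr (_ * _).
rewrite -[RHS]big_enum (big_nth i0) big_mkord -cardE card_ksubset.
by apply: eq_bigr => j _; rewrite !mxE.
Qed.

End Compound.

(** * The modulus of complex numbers *)

Section Modulus.
Variable R : realType.
Local Notation C := R[i].
Local Notation normc := (@Normc.normc R).

Lemma normcR (a : R) : normc a%:C%C = `|a|.
Proof. by rewrite /Normc.normc /= expr0n /= addr0 sqrtr_sqr. Qed.

Lemma normc_ge0 (z : C) : 0 <= normc z.
Proof. by case: z => a b; exact: sqrtr_ge0. Qed.

Lemma normc_ReIm (a b : R) : normc (a +i* b)%C <= `|a| + `|b|.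
Proof.
have -> : (a +i* b)%C = a%:C%C + 'i%C * b%:C%C.
  by apply/eqP; rewrite eq_complex /= !(mul0r, mulr0, mul1r, addr0, add0r, subr0, oppr0) !eqxx.
apply: le_trans (le_normcD _ _) _; rewrite Normc.normcM !normcR.
by rewrite {1}/Normc.normc /= expr0n /= expr1n add0r sqrtr1 mul1r.
Qed.

Lemma normc_sum I (r : seq I) (P : pred I) (f : I -> C) :
  normc (\sum_(i <- r | P i) f i) <= \sum_(i <- r | P i) normc (f i).
Proof.
elim/big_rec2: _ => [|i y z _ le]; first by rewrite (@Normc.normc0 R).
by apply: le_trans (le_normcD _ _) _; rewrite lerD2l.
Qed.

Lemma normc_prod I (r : seq I) (P : pred I) (f : I -> C) :
  normc (\prod_(i <- r | P i) f i) = \prod_(i <- r | P i) normc (f i).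
Proof. by apply: big_morph; [exact: Normc.normcM | exact: Normc.normc1]. Qed.

Lemma normc_det k (M : 'M[C]_k) (c : R) : (forall i j, normc (M i j) <= c) ->
  normc (\det M) <= #|{: 'S_k}|%:R * c ^+ k.
Proof.
move=> Mc; apply: le_trans (normc_sum _ _ _) _.
rewrite mulr_natl -sumr_const; apply: ler_sum => s _.
rewrite Normc.normcM normc_prod.
have -> : c ^+ k = \prod_(i < k) c by rewrite prodr_const card_ord.
have -> : normc ((-1) ^+ s) = 1.
  by case: (s : bool); rewrite ?expr1 ?expr0 ?normcN (@Normc.normc1 R).
by rewrite mul1r; apply: ler_prod => i _; rewrite normc_ge0 Mc.
Qed.

End Modulus.

(** * Arbitrary vector norms, compared with coordinates *)

Section VectorNorm.
Local Open Scope classical_set_scope.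
Variables (R : realType) (p : nat).
Local Notation C := R[i].
Local Notation normc := (@Normc.normc R).
Local Notation delta i := (delta_mx i 0 : 'cV[C]_p).

Section AnyNorm.
Variable nu : 'cV[C]_p -> R.
Hypothesis hnu : is_vnorm nu.

Lemma vnorm_ge0 x : 0 <= nu x. Proof. by case: hnu. Qed.
Lemma vnorm_eq0 x : nu x = 0 -> x = 0. Proof. by case: hnu => _ /(_ x). Qed.
Lemma vnormZ a x : nu (a *: x) = normc a * nu x. Proof. by case: hnu. Qed.
Lemma vnormD x y : nu (x + y) <= nu x + nu y. Proof. by case: hnu. Qed.

Lemma vnorm0 : nu 0 = 0.
Proof. by rewrite -(scale0r 0) vnormZ (@Normc.normc0 R) mul0r. Qed.

Lemma vnorm_gt0 x : x != 0 -> 0 < nu x.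
Proof.
move=> x0; rewrite lt_neqAle vnorm_ge0 andbT eq_sym.
by apply: contra_neq x0; exact: vnorm_eq0.
Qed.

Lemma vnorm_delta_gt0 i : 0 < nu (delta i).
Proof.
apply: vnorm_gt0; apply/eqP => /colP/(_ i)/eqP; rewrite !mxE !eqxx; exact/negP/oner_neq0.
Qed.

Lemma vnorm_sum I (r : seq I) (P : pred I) (f : I -> 'cV[C]_p) :
  nu (\sum_(i <- r | P i) f i) <= \sum_(i <- r | P i) nu (f i).
Proof.
elim/big_rec2: _ => [|i y z _ le]; first by rewrite vnorm0.
by apply: le_trans (vnormD _ _) _; rewrite lerD2l.
Qed.

Lemma cV_sum_delta (x : 'cV[C]_p) : x = \sum_i x i 0 *: delta i.
Proof. by rewrite [LHS]matrix_sum_delta; apply: eq_bigr => i _; rewrite big_ord1. Qed.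

Lemma vnorm_le_coords x : nu x <= \sum_i normc (x i 0) * nu (delta i).
Proof.
rewrite {1}(cV_sum_delta x); apply: le_trans (vnorm_sum _ _ _) _.
by apply: ler_sum => i _; rewrite vnormZ.
Qed.

Lemma exists_unit_vnorm : (0 < p)%N -> exists u, nu u = 1.
Proof.
move=> p_gt0; set i := Ordinal p_gt0; have d0 := vnorm_delta_gt0 i.
exists (((nu (delta i))^-1)%:C%C *: delta i).
by rewrite vnormZ normcR ger0_norm ?invr_ge0 ?ltW // mulVf // gt_eqF.
Qed.

(** Real coordinates on [C^p], so that compactness and the extreme value theorem can be applied to
    real row vectors. *)
Definition cV_of_ReIm (y : 'rV[R]_(p + p)) : 'cV[C]_p :=
  \col_i (y 0 (lshift p i) +i* y 0 (rshift p i))%C.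

Lemma cV_of_ReImB y z : cV_of_ReIm (y - z) = cV_of_ReIm y - cV_of_ReIm z.
Proof. by apply/colP => i; rewrite !mxE. Qed.

Lemma ler_coord_norm (y : 'rV[R]_(p + p)) j : `|y 0 j| <= `|y|.
Proof. 
rewrite [leRHS]/Num.norm /= mx_normrE; exact: (le_bigmax _ (fun x : 'I_1 * _ => `|y x.1 x.2|) (0, j)).
Qed.

(** [nu] is at most [K] times the max norm, hence [K]-Lipschitz by the triangle inequality. *)
Lemma cV_of_ReIm_continuous : continuous (nu \o cV_of_ReIm).
Proof.
(* The 2 accounts for the real and the imaginary part of each coordinate. *)
pose K := \sum_i 2 * nu (delta i).
have K0 : 0 <= K by apply: sumr_ge0 => i _; rewrite mulr_ge0 ?vnorm_ge0.
have bound y : nu (cV_of_ReIm y) <= K * `|y|.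
  apply: le_trans (vnorm_le_coords _) _; rewrite big_distrl /=; apply: ler_sum => i _.
  rewrite mulrAC ler_wpM2r ?vnorm_ge0 // mxE.
  by apply: le_trans (normc_ReIm _ _) _; rewrite mulrDl mul1r lerD ?ler_coord_norm.
have lip y z : `|nu (cV_of_ReIm y) - nu (cV_of_ReIm z)| <= K * `|y - z|.
  have half u v : nu (cV_of_ReIm u) - nu (cV_of_ReIm v) <= K * `|u - v|.
    rewrite lerBlDr; apply: le_trans (lerD (bound (u - v)) (lexx _)).
    by rewrite cV_of_ReImB; apply: le_trans (vnormD _ _); rewrite subrK.
  by rewrite ler_norml half andbT lerNl opprB distrC half.
move=> y; have Fy : Filter (nbhs y) by exact: nbhs_filter.
apply/cvgrPdist_le => e e0; apply: (proj2 (@nbhs_ballP R 'rV[R]_(p + p) y _)).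
(* Adding 1 keeps the divisor positive when [K] is 0. *)
exists (e / (K + 1)); first by rewrite /= divr_gt0 // ltr_wpDl.
move=> z; rewrite -ball_normE /= => yz; apply: le_trans (lip _ _) _.
apply: (@le_trans _ _ ((K + 1) * `|y - z|)); first by rewrite ler_wpM2r // lerDl.
by rewrite mulrC -ler_pdivlMr ?ltr_wpDl // ltW.
Qed.

(** On the compact unit sphere of the max norm, [nu] attains a minimum [m], positive by
    definiteness. By homogeneity the max norm is at most [nu / m], and a complex modulus is at most
    twice the max norm. *)
Lemma coord_le_vnorm : exists c : R, forall (x : 'cV[C]_p) i, normc (x i 0) <= c * nu x.
Proof.
have [p0|p_gt0] := posnP p; first by exists 0 => x i; have := leq_trans (ltn_ord i) (eq_leq p0).
pose S := [set y : 'rV[R]_(p + p) | `|y| = 1].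
have S_unit y : y != 0 -> `|y|^-1 *: y \in S.
  by move=> y0; rewrite inE /S /= normrZ normfV normr_id mulVf // normr_eq0.
have S_nonempty : S !=set0.
  pose y : 'rV[R]_(p + p) := const_mx 1.
  have y0 : y != 0.
    by apply/eqP => /rowP/(_ (lshift p (Ordinal p_gt0)))/eqP; rewrite !mxE oner_eq0.
  by exists (`|y|^-1 *: y); apply/set_mem/S_unit.
have S_compact : compact S.
  apply: bounded_closed_compact.
    by exists 1; split; [exact: real1 | move=> M M1 y /= ->; exact: ltW].
  rewrite /S -[X in closed X]/(Num.norm @^-1` [set (1 : R)]).
  by apply: closed_comp => [y _|]; [exact: norm_continuous | exact: closed_eq].
have [y /set_mem Sy ymin] := EVT_min_rV S_nonempty S_compact
  (continuous_subspaceT cV_of_ReIm_continuous).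
set m := (nu \o cV_of_ReIm) y in ymin.
have m0 : 0 < m.
  apply: vnorm_gt0; apply/eqP => /colP y0; move: Sy; rewrite /S /=.
  suff -> : y = 0 by rewrite normr0 => /esym/eqP; rewrite oner_eq0.
  apply/rowP => j; rewrite -(splitK j) [RHS]mxE.
  by case: (split j) => i /=; have := y0 i; rewrite !mxE => /eqP; rewrite eq_complex /=
    => /andP[/eqP ? /eqP ?].
exists (2 / m) => x i.
pose z : 'rV[R]_(p + p) := row_mx (\row_i complex.Re (x i 0)) (\row_i complex.Im (x i 0)).
have zx : cV_of_ReIm z = x.
  by apply/colP => l; rewrite mxE row_mxEl row_mxEr !mxE; case: (x l 0).
have [z0|z0] := eqVneq z 0.
  have -> : x = 0 by rewrite -zx z0; apply/colP => l; rewrite !mxE.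
  by rewrite vnorm0 mulr0 mxE (@Normc.normc0 R).
have := ymin _ (S_unit z z0).
have -> : (nu \o cV_of_ReIm) (`|z|^-1 *: z) = `|z|^-1 * nu x.
  have -> : `|z|^-1 * nu x = nu ((`|z|^-1)%:C%C *: x).
    by rewrite vnormZ normcR ger0_norm // invr_ge0.
  congr nu; rewrite -zx; apply/colP => l; rewrite !mxE.
  by apply/eqP; rewrite eq_complex /= !mul0r subr0 addr0 !eqxx.
rewrite mulrC ler_pdivlMr ?normr_gt0 // => le_m.
have zle : `|z| <= m^-1 * nu x by rewrite ler_pdivlMl // mulrC.
apply: (@le_trans _ _ (2 * `|z|)); last by rewrite -mulrA ler_pM2l.
rewrite -zx mxE; apply: le_trans (normc_ReIm _ _) _.
by rewrite mulrDl mul1r lerD ?ler_coord_norm.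
Qed.

End AnyNorm.

End VectorNorm.

(** * Absolute vector norms and induced operator norms *)

Section AbsoluteNorm.
Local Open Scope classical_set_scope.
Variables (R : realType) (p : nat) (eta : 'cV[R[i]]_p -> R).
Local Notation C := R[i].
Local Notation normc := (@Normc.normc R).
Local Notation delta i := (delta_mx i 0 : 'cV[C]_p).
Hypothesis heta : is_abs_vnorm eta.

Let heta' : is_vnorm eta := proj1 heta.

Lemma eq_abs_vnorm (x y : 'cV[C]_p) : (forall i, normc (x i 0) = normc (y i 0)) -> eta x = eta y.
Proof.
move=> xy; rewrite -(proj2 heta x) -(proj2 heta y); congr eta.
by apply/colP => i; rewrite !mxE xy.
Qed.

(* Up to phases [z = t x] at [l] with [t] in [0, 1], so that [z] is a convex
   combination of [x] and of [x] with the sign of its [l]-th entry changed. *)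
Lemma abs_vnorm_le1 (x z : 'cV[C]_p) l : (forall i, i != l -> z i 0 = x i 0) ->
  normc (z l 0) <= normc (x l 0) -> eta z <= eta x.
Proof.
(* If [x l 0] is 0, division by zero yields [t = 0], which is consistent since [z l 0] is then 0 as
   well. *)
move=> zx zl; pose t := normc (z l 0) / normc (x l 0).
have t0 : 0 <= t by rewrite divr_ge0 ?normc_ge0.
have [t1 tz] : t <= 1 /\ normc (z l 0) = t * normc (x l 0).
  have [x0|x0] := eqVneq (normc (x l 0)) 0.
    rewrite /t x0 invr0 !mulr0 ler01; split=> //.
    by apply/eqP; rewrite eq_le normc_ge0 -{1}x0 zl.
  by rewrite /t divfK // ler_pdivrMr ?mul1r // lt_neqAle eq_sym x0 normc_ge0.
pose s : 'cV[C]_p := \col_i (if i == l then - x i 0 else x i 0).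
have sx : eta s = eta x.
  by apply: eq_abs_vnorm => i; rewrite mxE; case: eqP => // _; rewrite normcN.
(* The weights satisfy [a + b = 1], which keeps the other entries, and [a - b = t], which scales
   entry [l] by [t]. *)
pose a := (1 + t) / 2; pose b := (1 - t) / 2.
have [a0 b0 ab1 abt] : [/\ 0 <= a, 0 <= b, a + b = 1 & a - b = t].
  by rewrite /a /b; split; lra.
have -> : eta z = eta (a%:C%C *: x + b%:C%C *: s).
  apply: eq_abs_vnorm => i; rewrite !mxE; case: eqP => [->|/eqP il].
    rewrite mulrN -mulrBl -rmorphB abt Normc.normcM normcR ger0_norm //.
  by rewrite zx // -mulrDl -rmorphD ab1 rmorph1 mul1r.
apply: le_trans (vnormD heta' _ _) _; rewrite !(vnormZ heta') !normcR sx !ger0_norm //.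
by rewrite -mulrDl ab1 mul1r.
Qed.

(** Entries of [x] are replaced by those of [z] one at a time; [u m] is the vector after [m]
    replacements. *)
Lemma abs_vnorm_le (x z : 'cV[C]_p) : (forall i, normc (z i 0) <= normc (x i 0)) -> eta z <= eta x.
Proof.
move=> zx; pose u m : 'cV[C]_p := \col_i (if (i < m)%N then z i 0 else x i 0).
have up : u p = z by apply/colP => i; rewrite mxE ltn_ord.
have u0 : u 0%N = x by apply/colP => i; rewrite mxE.
suff H m : (m <= p)%N -> eta (u m) <= eta x by rewrite -up H.
elim: m => [|m IH] ltmp; first by rewrite u0.
apply: le_trans (IH (ltnW ltmp)); apply: (@abs_vnorm_le1 _ _ (Ordinal ltmp)).
  by move=> i; rewrite -val_eqE /= !mxE ltnS [(i <= m)%N]leq_eqVlt => /negPf ->.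
by rewrite !mxE /= ltnn ltnSn.
Qed.

Lemma abs_vnorm_diag (d : 'rV[C]_p) (M : R) (x : 'cV[C]_p) : 0 <= M -> (forall i, normc (d 0 i) <= M) ->
  eta (diag_mx d *m x) <= M * eta x.
Proof.
move=> M0 dM; rewrite -[X in X * _](ger0_norm M0) -normcR -(vnormZ heta').
apply: abs_vnorm_le => i; rewrite mul_diag_mx !mxE !Normc.normcM normcR (ger0_norm M0).
by rewrite ler_wpM2r ?normc_ge0.
Qed.

Lemma coord_le_abs_vnorm (x : 'cV[C]_p) i : normc (x i 0) <= eta x / eta (delta i).
Proof.
rewrite ler_pdivlMr ?vnorm_delta_gt0 // -(vnormZ heta'); apply: abs_vnorm_le => j.
rewrite !mxE andbT; case: eqP => [->|_]; first by rewrite mulr1.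
by rewrite mulr0 (@Normc.normc0 R) normc_ge0.
Qed.

(** This makes the supremum in [induced_norm] one of a bounded set. The constant is monotone in the
    moduli of the entries of [M], so it is uniform over matrices with bounded entries. *)
Lemma abs_vnorm_mulmx (M : 'M[C]_p) x :
  eta (M *m x) <= (\sum_j \sum_i normc (M i j) * (eta (delta i) / eta (delta j))) * eta x.
Proof.
apply: le_trans (vnorm_le_coords heta' _) _.
rewrite exchange_big big_distrl /=; apply: ler_sum => i _; rewrite mxE big_distrl /=.
apply: (@le_trans _ _ (\sum_j normc (M i j) * normc (x j 0) * eta (delta i))).
  rewrite -big_distrl ler_wpM2r ?vnorm_ge0 //; apply: le_trans (normc_sum _ _ _) _.
  by apply: ler_sum => j _; rewrite Normc.normcM.
apply: ler_sum => j _; rewrite -!mulrA ler_wpM2l ?normc_ge0 // mulrC ler_wpM2l ?vnorm_ge0 //.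
by rewrite mulrC coord_le_abs_vnorm.
Qed.

Lemma induced_norm_le (M : 'M[C]_p) : (0 < p)%N ->
  induced_norm eta M <= \sum_j \sum_i normc (M i j) * (eta (delta i) / eta (delta j)).
Proof.
move=> p0; apply: ge_sup.
  by have [u u1] := exists_unit_vnorm heta' p0; exists (eta (M *m u)), u.
by move=> _ [x [x1 ->]]; apply: le_trans (abs_vnorm_mulmx _ _) _; rewrite x1 mulr1.
Qed.

(** Normalizing a nonzero [x] gives a competitor in the supremum. *)
Lemma le_induced_norm (M : 'M[C]_p) x : eta (M *m x) <= induced_norm eta M * eta x.
Proof.
have [->|x0] := eqVneq x 0; first by rewrite mulmx0 vnorm0 // mulr0.
have ex0 := vnorm_gt0 heta' x0; rewrite -ler_pdivrMr //.
apply: ub_le_sup.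
  exists (\sum_j \sum_i normc (M i j) * (eta (delta i) / eta (delta j))).
  by move=> _ [y [y1 ->]]; apply: le_trans (abs_vnorm_mulmx _ _) _; rewrite y1 mulr1.
exists (((eta x)^-1)%:C%C *: x); rewrite -scalemxAr !(vnormZ heta') normcR ger0_norm.
  by rewrite mulVf ?gt_eqF // mulrC.
by rewrite invr_ge0 ltW.
Qed.

End AbsoluteNorm.

(** * Finiteness of [theta] and the bound by column norms *)

Section CompoundBound.
Local Open Scope classical_set_scope.
Variables (R : realType) (n k : nat).
Variables (nu : 'cV[R[i]]_n -> R) (mu : 'M[R[i]]_('C(n, k)) -> R).
Local Notation C := R[i].
Local Notation normc := (@Normc.normc R).
Hypotheses (hk0 : (0 < k)%N) (hkn : (k <= n)%N).
Hypotheses (hnu : is_vnorm nu) (hmu : is_abs_opnorm mu).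

Let n_gt0 : (0 < n)%N := leq_trans hk0 hkn.
Let i0 : 'I_n := Ordinal n_gt0.

(** Columns of norm 1 have entries of modulus at most [c], so the minors, and with them the induced
    norms, are bounded uniformly in [B]. *)
Lemma theta_has_ubound : has_ubound [set t : R | exists B : 'M[C]_n,
  (forall i : 'I_n, nu (col i B) = 1) /\ t = mu (compound k B)].
Proof.
have [eta [heta muE]] := hmu; have [c cP] := coord_le_vnorm hnu.
(* The Leibniz bound on a [k x k] minor: [k!] terms, each of modulus at most [c ^+ k]. *)
pose K := #|{: 'S_k}|%:R * c ^+ k.
exists (\sum_j \sum_i K * (eta (delta_mx i 0) / eta (delta_mx j 0))).
move=> _ [B [B1 ->]]; rewrite muE.
apply: le_trans (induced_norm_le heta _ _) _; first by rewrite bin_gt0.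
apply: ler_sum => b _; apply: ler_sum => a _; apply: ler_wpM2r.
  by rewrite divr_ge0 // vnorm_ge0 //; case: heta.
rewrite mxE (minor_mxsub i0 _ (card_ksubset a) (card_ksubset b)).
apply: normc_det => i j; rewrite mxE.
by have := cP (col (kth i0 (ksubset b) j) B) (kth i0 (ksubset a) i); rewrite B1 mulr1 mxE.
Qed.

Lemma compound_eigenvalue_bound (A : 'M[C]_n) (lam : 'I_n -> C) :
  char_poly A = \prod_(i < n) ('X - (lam i)%:P) ->
  normc (\prod_(i < n | (i < k)%N) lam i) <= theta mu nu *
    \big[Num.max/0]_(S : {set 'I_n} | #|S| == k) \prod_(i in S) nu (col i A).
Proof.
move=> charA; have [eta [heta muE]] := hmu; have heta' : is_vnorm eta by case: heta.
have [x x0 Ax] := compound_eigenvector i0 hkn charA.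
set M := \big[Num.max/0]_(_ | _) _.
have [u u1] := exists_unit_vnorm hnu n_gt0.
(* A zero column cannot be normalized; any unit vector [u] serves, because its weight in [d] is
   0. *)
pose v i := if col i A == 0 then u else ((nu (col i A))^-1)%:C%C *: col i A.
pose B : 'M[C]_n := \matrix_(r, i) v i r 0.
have colB i : col i B = v i by apply/colP => r; rewrite !mxE.
have B1 i : nu (col i B) = 1.
  rewrite colB /v; case: eqVneq => // Ai0; have Ai := vnorm_gt0 hnu Ai0.
  by rewrite vnormZ // normcR ger0_norm ?invr_ge0 ?ltW // mulVf // gt_eqF.
pose d : 'rV[C]_n := \row_i (nu (col i A))%:C%C.
have AE : A = B *m diag_mx d.
  apply/matrixP => r i; rewrite mul_mx_diag !mxE /v.
  have [Ai0|Ai0] := eqVneq (col i A) 0.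
    by rewrite Ai0 vnorm0 // mulr0; move/colP: Ai0 => /(_ r); rewrite !mxE.
  by rewrite !mxE mulrC mulrA -rmorphM mulfV ?rmorph1 ?mul1r // gt_eqF ?vnorm_gt0.
(* After multiplication by [eta x], the left side becomes [eta (compound k A *m x)]. *)
have ex0 := vnorm_gt0 heta' x0; rewrite -(ler_pM2r ex0) -(vnormZ heta') -Ax.
rewrite AE (compound_mul_diag k i0) -mulmxA.
have muB : mu (compound k B) <= theta mu nu.
  by apply: (ub_le_sup theta_has_ubound); exists B.
apply: le_trans (le_induced_norm heta _ _) _; rewrite -muE -mulrA.
have M0 : 0 <= M by apply: bigmax_ge_id.
apply: (@le_trans _ _ (mu (compound k B) * (M * eta x))).
  apply: ler_wpM2l; last apply: abs_vnorm_diag => // a.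
    (* Nonnegativity of [mu (compound k B)] is read off at the nonzero vector [x]. *)
    rewrite -(pmulr_lge0 _ ex0) muE.
    exact: le_trans (vnorm_ge0 heta' _) (le_induced_norm heta _ _).
  rewrite mxE normc_prod (eq_bigr (fun i => nu (col i A))).
    by apply: le_bigmax_cond; rewrite card_ksubset.
  by move=> i _; rewrite mxE normcR ger0_norm // vnorm_ge0.
by apply: ler_wpM2r => //; rewrite mulr_ge0 // ltW.
Qed.

End CompoundBound.

Theorem theorem3p1 (R : realType) (n k : nat) (hk0 : (0 < k)%N) (hkn : (k <= n)%N)
    (nu : 'cV[R[i]]_n -> R) (mu : 'M[R[i]]_('C(n, k)) -> R)
    (hnu : is_vnorm nu) (hmu : is_abs_opnorm mu)
    (A : 'M[R[i]]_n) (lam : 'I_n -> R[i])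
    (hchar : char_poly A = \prod_(i < n) ('X - (lam i)%:P))
    (hord : forall i j : 'I_n, (i <= j)%N -> Normc.normc (lam j) <= Normc.normc (lam i)) :
  Normc.normc (\prod_(i < n | (i < k)%N) lam i) <=
  theta mu nu *
  Num.min (\big[Num.max/0]_(S : {set 'I_n} | #|S| == k) \prod_(i in S) nu (col i A))
          (\big[Num.max/0]_(S : {set 'I_n} | #|S| == k) \prod_(i in S) nu (row i A)^T).
Proof.
(* The minimum is one of its two arguments, so each bound is proved separately; rows of [A] are
   columns of [A^T], which has the same characteristic polynomial. *)
rewrite minElt; case: ifP => _; first exact: compound_eigenvalue_bound.
have charAT : char_poly A^T = \prod_(i < n) ('X - (lam i)%:P) by rewrite char_poly_tr.
apply: le_trans (compound_eigenvalue_bound hk0 hkn hnu hmu charAT) _.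
by under eq_bigr do under eq_bigr do rewrite -tr_row.
Qed.
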